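(* Let $K$ be a field, let $S=K[x_1,\ldots,x_n,y_1,\ldots,y_m]$, and let $q,r,s,t$ be integers with $0\leq q<s\leq n$ and $0\leq t<r\leq m$. Then for every $i\geq 1$, $$\beta_i(I_qJ_r+I_sJ_t)=\beta_i(I_qJ_r)+\beta_i(I_sJ_t)+\beta_{i-1}(I_sJ_r).$$
   Context: $I_l$ (resp. $J_p$) denotes the ideal of $S=K[x_1,\ldots,x_n,y_1,\ldots,y_m]$ generated by all square-free monomials of degree $l$ in the variables $x_1,\ldots,x_n$ (resp. of degree $p$ in the variables $y_1,\ldots,y_m$), with the convention $I_0=J_0=S$. $S$ carries the standard grading. For a graded ideal $I\subset S$ with minimal graded free resolution $0\to F_p\to\cdots\to F_1\to F_0\to I\to 0$ over $S$, $\beta_i(I)$ is the rank of the free module $F_i$ (the $i$-th total Betti number of $I$). Note that the resolution is of the ideal $I$ itself, not of $S/I$. *)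

(* Defs.v *)
From mathcomp Require Import all_boot all_order all_algebra.
From mathcomp Require Import mpoly.
From Stdlib Require Import ClassicalEpsilon.

Set Implicit Arguments.
Unset Strict Implicit.
Unset Printing Implicit Defensive.

Import GRing.Theory.
Local Open Scope ring_scope.

Section Ideals.
Variable S : comNzRingType.

(* Ideals are represented by their membership predicates. *)
Definition ideal_gen (G : S -> Prop) : S -> Prop := fun f =>
  exists (k : nat) (a g : 'I_k -> S),
    (forall j, G (g j)) /\ f = \sum_(j < k) a j * g j.

Definition ideal_add (I J : S -> Prop) : S -> Prop := fun f =>
  exists g h : S, [/\ I g, J h & f = g + h].

Definition ideal_mul (I J : S -> Prop) : S -> Prop :=
  ideal_gen (fun f => exists g h : S, [/\ I g, J h & f = g * h]).

End Ideals.

Section BettiNumbers.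
Variables (N : nat) (K : fieldType).
Local Notation S := {mpoly K[N]}.

(* The zero polynomial satisfies this for every e, and it is the only one to do
   so when e < 0. *)
Definition homog_of_degree (e : int) (p : S) : Prop :=
  forall mu : 'X_{1..N}, mu \in msupp p -> (mdeg mu)%:Z = e.

Definition irrelevant_ideal : S -> Prop :=
  ideal_gen (fun f => exists i : 'I_N, f = 'X_i).

(* F_i = \bigoplus_j S(- shift i j), of rank [rank i], whose elements are row
   vectors; the maps F_{i+1} -> F_i and F_0 -> S are v |-> v *m diff i and
   v |-> v *m aug. *)
Record free_seq := FreeSeq {
  rank  : nat -> nat;
  shift : forall i : nat, 'I_(rank i) -> int;
  diff  : forall i : nat, 'M[S]_(rank i.+1, rank i);
  aug   : 'cV[S]_(rank 0)
}.

(* All maps are homogeneous of degree 0. *)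
Definition graded_maps (F : free_seq) : Prop :=
  (forall j : 'I_(rank F 0), homog_of_degree (shift j) (aug F j 0)) /\
  (forall (i : nat) (j : 'I_(rank F i.+1)) (k : 'I_(rank F i)),
     homog_of_degree (shift j - shift k) (diff F i j k)).

(* ... -> F_1 -> F_0 -> I -> 0 is exact. *)
Definition resolves (F : free_seq) (I : S -> Prop) : Prop :=
  [/\ forall f : S, I f <-> exists v : 'rV[S]_(rank F 0), f = (v *m aug F) 0 0,
      forall v : 'rV[S]_(rank F 0),
        v *m aug F = 0 <-> exists w : 'rV[S]_(rank F 1), v = w *m diff F 0
    & forall (i : nat) (v : 'rV[S]_(rank F i.+1)),
        v *m diff F i = 0 <->
        exists w : 'rV[S]_(rank F i.+2), v = w *m diff F i.+1].

Definition finite_length (F : free_seq) : Prop :=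
  exists p : nat, forall i : nat, (p < i)%N -> rank F i = 0%N.

(* The image of F_{i+1} -> F_i lies in m F_i, m being the irrelevant ideal. *)
Definition minimal (F : free_seq) : Prop :=
  forall (i : nat) (j : 'I_(rank F i.+1)) (k : 'I_(rank F i)),
    irrelevant_ideal (diff F i j k).

Definition minimal_graded_free_resolution (F : free_seq) (I : S -> Prop) :
  Prop := [/\ graded_maps F, resolves F I, finite_length F & minimal F].

(* Every graded ideal has a minimal graded free resolution, and its ranks do not
   depend on the resolution, so that this determines the value for graded I;
   it is unspecified for other I. *)
Definition betti (i : nat) (I : S -> Prop) : nat :=
  epsilon (inhabits 0%N) (fun b : nat =>
    exists F : free_seq, minimal_graded_free_resolution F I /\ rank F i = b).

End BettiNumbers.

Section SquarefreeVeronese.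
Variables (n m : nat) (K : fieldType).
Local Notation S := {mpoly K[n + m]}.

Definition xvar (i : 'I_n) : S := 'X_(lshift m i).
Definition yvar (j : 'I_m) : S := 'X_(rshift n j).

(* For l = 0 (resp. p = 0) the only generator is the empty product 1, so the
   ideal is the whole ring. *)
Definition Iideal (l : nat) : S -> Prop :=
  ideal_gen (fun f => exists A : {set 'I_n},
    #|A| = l /\ f = \prod_(i in A) xvar i).

Definition Jideal (p : nat) : S -> Prop :=
  ideal_gen (fun f => exists B : {set 'I_m},
    #|B| = p /\ f = \prod_(j in B) yvar j).

End SquarefreeVeronese.

Arguments Iideal n m K l _ : clear implicits.
Arguments Jideal n m K p _ : clear implicits.

(* Main.v *)
Require Import Defs.
From mathcomp Require Import all_boot all_order all_algebra.
From mathcomp Require Import mpoly.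
From Stdlib Require Import ClassicalEpsilon.

(** The proof is a Betti splitting.  Since q < s and t < r, a monomial lies in both
    I_q J_r and I_s J_t exactly when it lies in I_s J_r, so there is a short exact
    sequence 0 -> I_s J_r -> I_q J_r (+) I_s J_t -> I_q J_r + I_s J_t -> 0.  Every
    product I_a J_b has a linear resolution: the i-th module is generated in degree
    a + b + i.  Lift the two inclusions of I_s J_r to maps of graded resolutions.
    In homological degree i they go from degree s + r + i to the strictly smaller
    degrees q + r + i and s + t + i, so their matrices have entries in the
    irrelevant ideal.  The mapping cone is therefore a minimal resolution of the sum
    ([resolution_ideal_add]), and its i-th rank is the right-hand side.

    Two further ingredients make this a statement about Betti numbers.  The ranks of
    a minimal resolution depend on the ideal only ([betti_rank]): comparison maps in
    both directions compose to a map homotopic to the identity, and modulo the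
    irrelevant ideal the homotopy vanishes, so the maps become one-sided inverses
    over the field.  And the linear resolutions exist ([linear_bisupport]) because
    the same mapping cone builds them one variable at a time: if W a is the set of
    monomials involving at least a of the variables in a list s, then for a new
    variable x the monomials involving at least a + 1 of the variables x :: s form
    the union of W (a + 1) and of the multiples of x in W a, and those two sets
    meet in the multiples of x in W (a + 1), whose ideal is x times a known one. *)

Section BettiSplitting.
Set Implicit Arguments.
Unset Strict Implicit.
Unset Printing Implicit Defensive.
Import Order.TTheory GRing.Theory Num.Theory.
Local Open Scope ring_scope.

(** * Supports, homogeneity and graded matrices *)

Section Support.

Variables (N : nat) (K : fieldType).
Local Notation S := {mpoly K[N]}.
Implicit Types (p q : S) (mu nu : 'X_{1..N}) (W : 'X_{1..N} -> Prop).

(** For upward closed [W] this is the monomial ideal spanned by [W], and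
    [homog_of_degree e] is the case of the monomials of degree [e]: both rest on the
    same closure properties. *)
Definition supported W p := forall mu, mu \in msupp p -> W mu.

Lemma supportedP W p : supported W p <-> forall mu, ~ W mu -> p@_mu = 0.
Proof.
split=> [pW mu nW|pW mu].
  by apply/eqP; rewrite mcoeff_eq0; apply/negP => /pW.
by rewrite mcoeff_msupp => /eqP pmu; case: (classic (W mu)) => // /pW.
Qed.

Lemma supported0 W : supported W 0.
Proof. by apply/supportedP => mu _; rewrite mcoeff0. Qed.

Lemma supportedD W p q : supported W p -> supported W q -> supported W (p + q).
Proof.
move=> /supportedP pW /supportedP qW; apply/supportedP => mu nW.
by rewrite mcoeffD pW // qW // addr0.
Qed.

Lemma supportedN W p : supported W p -> supported W (- p).
Proof.
by move=> /supportedP pW; apply/supportedP => mu nW; rewrite mcoeffN pW // oppr0.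
Qed.

Lemma supported_sum W (J : Type) (s : seq J) (P : pred J) (F : J -> S) :
  (forall j, P j -> supported W (F j)) -> supported W (\sum_(j <- s | P j) F j).
Proof.
by move=> FW; apply: big_ind => //; [apply: supported0 | move=> x y; apply: supportedD].
Qed.

Lemma supportedM W W1 W2 p q :
    (forall mu nu, W1 mu -> W2 nu -> W (mu + nu)%MM) ->
  supported W1 p -> supported W2 q -> supported W (p * q).
Proof.
by move=> W12 pW qW mu /msuppM_le /allpairsP [[m1 m2] /= [/pW ? /qW ? ->]]; apply: W12.
Qed.

Lemma supportedZX W c mu : W mu -> supported W (c *: 'X_[mu]).
Proof. by move=> Wmu nu /msuppZ_le /mem_msuppXP <-. Qed.

Lemma supported_sub W1 W2 p :
  (forall mu, W1 mu -> W2 mu) -> supported W1 p -> supported W2 p.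
Proof. by move=> W12 pW mu /pW /W12. Qed.

Lemma supported_disjoint W1 W2 p :
    (forall mu, W1 mu -> W2 mu -> False) ->
  supported W1 p -> supported W2 p -> p = 0.
Proof.
move=> W12 pW1 pW2; apply/mpolyP => mu; rewrite mcoeff0; apply/eqP.
by rewrite mcoeff_eq0; apply/negP => mup; apply: (W12 mu); [apply: pW1 | apply: pW2].
Qed.

Definition restrict (P : pred 'X_{1..N}) p : S :=
  \sum_(mu <- msupp p | P mu) p@_mu *: 'X_[mu].

Lemma supported_restrict (P : pred 'X_{1..N}) p : supported P (restrict P p).
Proof. by apply: supported_sum => mu Pmu; apply: supportedZX. Qed.

Lemma restrictC (P : pred 'X_{1..N}) p : p = restrict P p + restrict (predC P) p.
Proof. by rewrite {1}(mpolyE p) (bigID P). Qed.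

Lemma supported_restrict_sub W (P : pred 'X_{1..N}) p :
  supported W p -> supported W (restrict P p).
Proof.
move=> pW; rewrite /restrict big_seq_cond; apply: supported_sum => mu /andP[mup _].
exact: supportedZX (pW _ mup).
Qed.

Lemma homogM d e p q :
  homog_of_degree d p -> homog_of_degree e q -> homog_of_degree (d + e) (p * q).
Proof.
by apply: supportedM => mu nu Hmu Hnu; rewrite mdegD PoszD Hmu Hnu.
Qed.

Lemma ideal_gen_monomials (G : S -> Prop) p :
    (forall mu, mu \in msupp p -> exists c g, G g /\ 'X_[mu] = c * g) ->
  ideal_gen G p.
Proof.
move=> pG; set t := in_tuple (msupp p).
have /fin_all_exists [c /fin_all_exists [g cgP]] (j : 'I_(size (msupp p))) :
    exists c g, G g /\ 'X_[tnth t j] = c * g.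
  by apply: pG; rewrite mem_tnth.
exists _, (fun j => p@_(tnth t j) *: c j), g; split=> [j|]; first by case: (cgP j).
rewrite [LHS]mpolyE (big_tnth _ _ (msupp p)); apply: eq_bigr => j _.
by have [_ ->] := cgP j; rewrite scalerAl.
Qed.

Lemma ideal_gen_self (G : S -> Prop) p : G p -> ideal_gen G p.
Proof.
by move=> Gp; exists 1%N, (fun=> 1), (fun=> p); split=> //; rewrite big_ord1 mul1r.
Qed.

Lemma supported_ideal_gen W (G : S -> Prop) p :
    (forall mu nu, W mu -> W (nu + mu)%MM) -> (forall g, G g -> supported W g) ->
  ideal_gen G p -> supported W p.
Proof.
move=> Wup GW [k [a [g [Gg ->]]]]; apply: supported_sum => j _.
by apply: (supportedM (W1 := fun=> True) _ _ (GW _ (Gg j))) => // mu nu _; apply: Wup.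
Qed.

Lemma irrelevant_idealP p : irrelevant_ideal p <-> p@_0 = 0.
Proof.
split=> [[k [a [g [gX ->]]]]|p0].
  rewrite raddf_sum big1 // => j _; have [i ->] := gX j.
  by have := rmorphM (mcoeff 0 : {rmorphism S -> K}) (a j) 'X_i => /= ->;
     rewrite mcoeffX mnm1_eq0 mulr0.
apply: ideal_gen_monomials => mu mup.
have /existsP[x mux] : [exists x : 'I_N, mu x != 0%N].
  apply: contraTT mup; rewrite negb_exists => /forallP mu0.
  suff -> : mu = 0%MM by rewrite mcoeff_msupp p0 eqxx.
  by apply/mnmP => x; rewrite mnm0E; apply/eqP; rewrite -[_ == _]negbK mu0.
exists 'X_[mu - U_(x)], 'X_x; split; first by exists x.
by rewrite -mpolyXD submK // lep1mP.
Qed.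

Definition constant_part : {rmorphism S -> K} := mcoeff 0.

(** The matrix of a map of degree 0 from the sum of the S(- sa j) to that of the
    S(- sb k), acting on row vectors: [D j k] carries a generator of degree [sa j] to
    a multiple of one of degree [sb k]. *)
Definition graded_mx a b (sa : 'I_a -> int) (sb : 'I_b -> int) (D : 'M[S]_(a, b)) :=
  forall j k, homog_of_degree (sa j - sb k) (D j k).

Lemma graded_mulmx a b c (sa : 'I_a -> int) (sb : 'I_b -> int) (sc : 'I_c -> int)
    (A : 'M_(a, b)) (B : 'M_(b, c)) :
  graded_mx sa sb A -> graded_mx sb sc B -> graded_mx sa sc (A *m B).
Proof.
move=> gA gB j k; rewrite mxE; apply: supported_sum => l _.
by have := homogM (gA j l) (gB l k); rewrite addrA subrK.
Qed.

Lemma positive_degree_constant_part a b (sa : 'I_a -> int) (sb : 'I_b -> int)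
    (D : 'M[S]_(a, b)) :
    graded_mx sa sb D -> (forall j k, sb k < sa j) -> map_mx constant_part D = 0.
Proof.
move=> gD lt; apply/matrixP => j k; rewrite !mxE; apply/eqP.
rewrite [constant_part _ == 0]mcoeff_eq0; apply/negP => /gD /eqP.
by rewrite mdeg0 eq_sym subr_eq0 gt_eqF.
Qed.

(** Keeping in each coordinate of [w] only the degree forced by the shifts does not
    change [w *m D]: the discarded monomials contribute only to degrees in which the
    homogeneous row [v] has no monomial. *)
Lemma graded_factor_row a b (sa : 'I_a -> int) (sb : 'I_b -> int) (e : int)
    (D : 'M_(a, b)) (v : 'rV_b) (w : 'rV_a) :
    graded_mx sa sb D -> graded_mx (fun=> e) sb v -> v = w *m D ->
  exists2 w', graded_mx (fun=> e) sa w' & v = w' *m D.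
Proof.
move=> gD gv vE.
pose P j := [pred mu : 'X_{1..N} | (mdeg mu)%:Z == e - sa j].
pose w' := \row_j restrict (P j) (w 0 j).
exists w' => [i j|].
  by rewrite mxE; apply: supported_sub (@supported_restrict _ _) => mu /eqP.
have gw' : graded_mx (fun=> e) sa w'.
  by move=> i j; rewrite mxE; apply: supported_sub (@supported_restrict _ _) => mu /eqP.
apply/eqP; rewrite -subr_eq0; apply/eqP/rowP => k; rewrite [RHS]mxE.
apply: (@supported_disjoint (fun mu => (mdeg mu)%:Z = e - sb k)
                            (fun mu => (mdeg mu)%:Z <> e - sb k)) => //.
  rewrite !mxE; apply: supportedD; first exact: gv.
  by apply: supportedN; have /(_ 0 k) := graded_mulmx gw' gD; rewrite mxE.
rewrite vE -mulmxBl mxE; apply: supported_sum => j _.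
have -> : (w - w') 0 j = restrict (predC (P j)) (w 0 j).
  by rewrite !mxE {1}(restrictC (P j) (w 0 j)) addrC addKr.
apply: supportedM (@supported_restrict (predC (P j)) (w 0 j)) (gD j k) => mu nu /= Pmu nuE.
rewrite mdegD PoszD nuE => muE; case/negP: Pmu; apply/eqP.
by apply: (addIr (sa j - sb k)); rewrite muE addrA subrK.
Qed.

(** This is graded projectivity of free modules, in matrix form. *)
Lemma graded_factor a b c (sa : 'I_a -> int) (sb : 'I_b -> int) (sc : 'I_c -> int)
    (D : 'M_(a, b)) (V : 'M_(c, b)) :
    graded_mx sa sb D -> graded_mx sc sb V ->
    (forall v : 'rV_c, exists w : 'rV_a, v *m V = w *m D) ->
  exists2 W, graded_mx sc sa W & V = W *m D.
Proof.
move=> gD gV VD.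
have /fin_all_exists2 [W gW WE] (i : 'I_c) :
    exists2 w : 'rV_a, graded_mx (fun=> sc i) sa w & row i V = w *m D.
  have [w wE] := VD (delta_mx 0 i); apply: graded_factor_row gD _ _.
    by move=> j k; rewrite mxE; apply: gV.
  by rewrite rowE wE.
exists (\matrix_i W i) => [i k|]; first by rewrite mxE; apply: gW.
by apply/row_matrixP => i; rewrite row_mul rowK.
Qed.
End Support.

(** * Comparison of resolutions and uniqueness of the ranks *)

Section Complexes.

Variables (N : nat) (K : fieldType).
Local Notation S := {mpoly K[N]}.
Implicit Types (F G H : free_seq N K) (I J : S -> Prop).

(** The augmented complex, re-indexed so that the ring itself sits in position 0:
    exactness and the lifting of maps then need no separate treatment of the
    augmentation. *)
Definition arank F (i : nat) : nat := if i is i'.+1 then rank F i' else 1.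

Definition ashift F (i : nat) : 'I_(arank F i) -> int :=
  match i with 0 => fun=> 0 | i'.+1 => @shift _ _ F i' end.

Definition amap F (i : nat) : 'M[S]_(arank F i.+1, arank F i) :=
  match i with 0 => aug F | i'.+1 => diff F i' end.

Lemma graded_amap F i :
  graded_maps F -> graded_mx (@ashift F i.+1) (@ashift F i) (amap F i).
Proof.
case=> gaug gdiff; case: i => [|i] j k /=; last exact: gdiff.
by rewrite ord1 subr0.
Qed.

Lemma amap_exact F I i (v : 'rV_(arank F i.+1)) :
  resolves F I -> v *m amap F i = 0 <-> exists w, v = w *m amap F i.+1.
Proof. by case=> _ ex0 exS; case: i v => [|i] v /=; [apply: ex0 | apply: exS]. Qed.

Lemma amap_image F I (v : 'M_1) :
  resolves F I -> I (v 0 0) <-> exists w, v = w *m amap F 0.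
Proof.
case=> imF _ _; split=> [/imF[w wE]|[w ->]]; last by apply/imF; exists w.
by exists w; apply/rowP => k; rewrite !ord1 wE.
Qed.

Lemma amap_amap F I i : resolves F I -> amap F i.+1 *m amap F i = 0.
Proof.
move=> Fres; apply/row_matrixP => j; rewrite row_mul row0.
by apply/(amap_exact _ Fres); exists (delta_mx 0 j); rewrite rowE.
Qed.

(** The comparison theorem.  The next component exists as soon as the image of the
    composite [amap F i *m phi i] lies in that of [amap G i]; this is the invariant
    carried by the recursion, and exactness of [G] renews it. *)
Lemma lift_chain F G I J :
    graded_maps F -> graded_maps G -> resolves F I -> resolves G J ->
    (forall f, I f -> J f) ->
  exists phi : forall i, 'M[S]_(arank F i, arank G i),
    [/\ phi 0 = 1%:M,
        forall i, graded_mx (@ashift F i) (@ashift G i) (phi i)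
      & forall i, phi i.+1 *m amap G i = amap F i *m phi i].
Proof.
move=> gF gG Fres Gres IJ.
pose liftable i (A : 'M_(arank F i, arank G i)) :=
  graded_mx (@ashift F i) (@ashift G i) A /\
  forall v : 'rV_(arank F i.+1), exists w, v *m (amap F i *m A) = w *m amap G i.
have step i (A : {A | liftable i A}) :
    {B : {B | liftable i.+1 B} | sval B *m amap G i = amap F i *m sval A}.
  case: A => A [gA imA] /=; apply: constructive_indefinite_description.
  have [B gB BE] := graded_factor (@graded_amap G i gG)
                      (graded_mulmx (@graded_amap F i gF) gA) imA.
  suffices Blift : liftable i.+1 B by exists (exist _ B Blift).
  split=> // v; apply/(amap_exact _ Gres).
  by rewrite -!mulmxA -BE [amap F _ *m (_ *m _)]mulmxA (amap_amap i Fres) mul0mx mulmx0.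
have lift0 : liftable 0%N 1%:M.
  split=> [j k|v]; rewrite /=.
    rewrite !ord1 mxE eqxx subr0 => mu; rewrite -mpolyX0 => /mem_msuppXP <-.
    by rewrite mdeg0.
  rewrite mulmx1; apply/(amap_image _ Gres)/IJ/(amap_image _ Fres).
  by exists v.
pose fix phi i : {A | liftable i A} :=
  match i with 0 => exist _ 1%:M lift0 | i'.+1 => sval (step i' (phi i')) end.
exists (fun i => sval (phi i)); split=> // i; first by case: (svalP (phi i)).
exact: svalP (step i (phi i)).
Qed.

(** Uniqueness of lifts up to homotopy.  Only the components [h] and [h'] around one
    index are needed below, so each index gets its own pair instead of one global
    homotopy.  In position 0 the lift is the identity and [h] can be taken zero;
    this matters because the augmentation, unlike the differentials, need not have
    entries in the irrelevant ideal. *)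
Lemma homotopy F I (theta : forall i, 'M[S]_(arank F i)) :
    resolves F I -> theta 0%N = 1%:M ->
    (forall i, theta i.+1 *m amap F i = amap F i *m theta i) ->
  forall i, exists (h : 'M_(arank F i, arank F i.+1))
                   (h' : 'M_(arank F i.+1, arank F i.+2)),
    (i = 0%N -> h = 0) /\ theta i.+1 - 1%:M = amap F i *m h + h' *m amap F i.+1.
Proof.
move=> Fres th0 thS.
have factor i (A : 'M_(arank F i.+1)) : A *m amap F i = 0 ->
    exists h : 'M_(arank F i.+1, arank F i.+2), A = h *m amap F i.+1.
  move=> A0; have /fin_all_exists [h hE] j :
      exists w, row j A = w *m amap F i.+1.
    by apply/(amap_exact _ Fres); rewrite -row_mul A0 row0.
  by exists (\matrix_j h j); apply/row_matrixP => j; rewrite row_mul rowK.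
elim=> [|i [h [h' [_ hE]]]].
  have [|h' h'E] := factor 0%N (theta 1%N - 1%:M).
    by rewrite mulmxBl thS th0 mulmx1 mul1mx subrr.
  by exists 0, h'; rewrite mulmx0 add0r.
have [|h'' h''E] := factor i.+1 (theta i.+2 - 1%:M - amap F i.+1 *m h').
  rewrite !mulmxBl mul1mx thS -mulmxA -{2}[amap F i.+1]mulmx1 -!mulmxBr.
  by rewrite hE addrK mulmxA (amap_amap i Fres) mul0mx.
by exists h', h''; split=> //; rewrite -[LHS](subrK (amap F i.+1 *m h')) h''E addrC.
Qed.

Lemma minimalP F :
  minimal F <-> forall i, map_mx (constant_part N K) (diff F i) = 0.
Proof.
split=> [minF i|F0 i j k].
  by apply/matrixP => a b; rewrite !mxE; apply/irrelevant_idealP/minF.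
by apply/irrelevant_idealP; have /matrixP/(_ j k) := F0 i; rewrite !mxE.
Qed.

(** Modulo the irrelevant ideal the homotopy formula reads
    [phi i.+1 *m psi i.+1 = 1%:M], and over a field a matrix with a right inverse
    has at most as many rows as columns. *)
Lemma rank_le F G I :
  minimal_graded_free_resolution F I -> minimal_graded_free_resolution G I ->
  forall i, (rank F i <= rank G i)%N.
Proof.
move=> [gF Fres _ minF] [gG Gres _ _] i.
have [phi [phi0 _ phiS]] := lift_chain gF gG Fres Gres (fun f If => If).
have [psi [psi0 _ psiS]] := lift_chain gG gF Gres Fres (fun f If => If).
have [|k|h [h' [h0 hE]]] := homotopy (theta := fun k => phi k *m psi k) Fres _ _ i.
- by rewrite phi0 psi0 mulmx1.
- by rewrite -mulmxA psiS !mulmxA phiS.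
have diff0 k : map_mx (constant_part N K) (diff F k) = 0 by move: k; apply/minimalP.
apply: (@mulmx1_min _ _ _ (map_mx (constant_part N K) (phi i.+1))
                            (map_mx (constant_part N K) (psi i.+1))).
rewrite -map_mxM -[_ *m _](subrK 1%:M) hE !(map_mxD, map_mxM) map_mx1.
rewrite [map_mx _ (amap F i.+1)]diff0 mulmx0 addr0.
case: i h h0 {h' hE} => [|i] h h0; first by rewrite h0 // map_mx0 mulmx0 add0r.
by rewrite [map_mx _ (amap F i.+1)]diff0 mul0mx add0r.
Qed.

Lemma betti_rank F I i :
  minimal_graded_free_resolution F I -> betti i I = rank F i.
Proof.
move=> Fmin; rewrite /betti.
have [|G [Gmin <-]] := epsilon_spec (inhabits 0%N) (fun b : nat =>
    exists F : free_seq N K, minimal_graded_free_resolution F I /\ rank F i = b).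
  by exists (rank F i), F.
by apply/eqP; rewrite eqn_leq (rank_le Gmin Fmin) (rank_le Fmin Gmin).
Qed.

Lemma resolution_ext F I J :
    (forall f, I f <-> J f) ->
  minimal_graded_free_resolution F I -> minimal_graded_free_resolution F J.
Proof.
by move=> IJ [? [imF ? ?] ? ?]; split=> //; split=> // f; rewrite -IJ.
Qed.
End Complexes.

(** * Minimal resolution of a sum by the mapping cone *)

Section Cone.

Variables (N : nat) (K : fieldType).
Local Notation S := {mpoly K[N]}.
Implicit Types (F G H : free_seq N K) (I J : S -> Prop).

Definition split_shift a b (sa : 'I_a -> int) (sb : 'I_b -> int) (j : 'I_(a + b)) : int :=
  match split j with inl k => sa k | inr k => sb k end.

Lemma graded_block_mx a1 a2 b1 b2 (sa1 : 'I_a1 -> int) (sa2 : 'I_a2 -> int)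
    (sb1 : 'I_b1 -> int) (sb2 : 'I_b2 -> int) (A : 'M[S]_(a1, b1)) B C D :
    graded_mx sa1 sb1 A -> graded_mx sa1 sb2 B ->
    graded_mx sa2 sb1 C -> graded_mx sa2 sb2 D ->
  graded_mx (split_shift sa1 sa2) (split_shift sb1 sb2) (block_mx A B C D).
Proof.
move=> gA gB gC gD j k; rewrite /split_shift.
by case: (split_ordP j) => j' ->; case: (split_ordP k) => k' ->;
  rewrite ?(block_mxEul, block_mxEur, block_mxEdl, block_mxEdr).
Qed.

Lemma graded_mx0 a b (sa : 'I_a -> int) (sb : 'I_b -> int) :
  graded_mx sa sb (0 : 'M[S]_(a, b)).
Proof. by move=> j k; rewrite mxE; apply: supported0. Qed.

Lemma graded_mxN a b (sa : 'I_a -> int) (sb : 'I_b -> int) (D : 'M[S]_(a, b)) :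
  graded_mx sa sb D -> graded_mx sa sb (- D).
Proof. by move=> gD j k; rewrite mxE; apply: supportedN; apply: gD. Qed.

(** The third summand of the cone: the resolution of the intersection moved up by one
    homological degree, its augmentation dropped and position 0 left empty. *)
Definition susp_rank H (i : nat) : nat := if i is i'.+1 then rank H i' else 0.

Definition susp_shift H (i : nat) : 'I_(susp_rank H i) -> int :=
  match i with 0 => fun=> 0 | i'.+1 => @shift _ _ H i' end.

Definition susp_diff H (i : nat) : 'M[S]_(susp_rank H i.+1, susp_rank H i) :=
  match i with 0 => 0 | i'.+1 => diff H i' end.

Section Construction.
Variables (F G H : free_seq N K).
Variables (phi : forall i, 'M[S]_(arank H i, arank F i))
          (psi : forall i, 'M[S]_(arank H i, arank G i)).

(** The cone of the map [H -> F (+) G] with components [phi] and [- psi].  The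
    opposite signs make the image in degree 0 the antidiagonal copy of the
    intersection, which is the kernel of the addition map. *)
Definition cone : free_seq N K :=
  @FreeSeq N K (fun i => (rank F i + rank G i + susp_rank H i)%N)
    (fun i => split_shift (split_shift (@shift _ _ F i) (@shift _ _ G i)) (@susp_shift H i))
    (fun i => block_mx (block_mx (diff F i) 0 0 (diff G i)) 0
                       (row_mx (phi i.+1) (- psi i.+1)) (- susp_diff H i))
    (col_mx (col_mx (aug F) (aug G)) 0).

Lemma cone_graded :
    graded_maps F -> graded_maps G -> graded_maps H ->
    (forall i, graded_mx (@ashift _ _ H i) (@ashift _ _ F i) (phi i)) ->
    (forall i, graded_mx (@ashift _ _ H i) (@ashift _ _ G i) (psi i)) ->
  graded_maps cone.
Proof.
move=> [aF dF] [aG dG] [aH dH] gphi gpsi; split=> [j|i] /=.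
  rewrite /split_shift; case: (split_ordP j) => [j' ->|[]//].
  rewrite col_mxEu.
  by case: (split_ordP j') => k ->; rewrite ?(col_mxEu, col_mxEd).
apply: graded_block_mx.
- by apply: graded_block_mx => //; apply: graded_mx0.
- exact: graded_mx0.
- move=> j k; rewrite /split_shift; case: (split_ordP k) => k' ->.
    by rewrite row_mxEl; apply: (gphi i.+1).
  by rewrite row_mxEr; apply: (graded_mxN (gpsi i.+1)).
- by apply: graded_mxN; case: i => [|i] //=; apply: graded_mx0.
Qed.

Lemma cone_finite_length :
  finite_length F -> finite_length G -> finite_length H -> finite_length cone.
Proof.
move=> [a Fa] [b Gb] [c Hc]; exists (maxn a (maxn b c.+1)) => i.
rewrite !gtn_max => /and3P[ai bi ci] /=; rewrite Fa // Gb //.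
by case: i ci {ai bi} => //= i ci; rewrite Hc.
Qed.

Variables I J : S -> Prop.
Hypotheses (Fres : resolves F I) (Gres : resolves G J)
           (Hres : resolves H (fun f => I f /\ J f)).
Hypotheses (phi0 : phi 0%N = 1%:M) (psi0 : psi 0%N = 1%:M)
  (phiS : forall i, phi i.+1 *m amap F i = amap H i *m phi i)
  (psiS : forall i, psi i.+1 *m amap G i = amap H i *m psi i).

(** The diagram chase common to all degrees: once the two components over [F] and
    [G] are traced back to one element [h'] over the intersection, subtracting the
    image of [h'] leaves cycles of [F] and of [G], which are boundaries. *)
Lemma cone_image i (f : 'rV_(rank F i)) (g : 'rV_(rank G i)) (h : 'rV_(susp_rank H i))
    (h' : 'rV_(rank H i)) :
    f *m amap F i = h' *m amap H i *m phi i ->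
    g *m amap G i = - (h' *m amap H i *m psi i) ->
    h = - (h' *m susp_diff H i) ->
  exists w, row_mx (row_mx f g) h = w *m diff cone i.
Proof.
move=> fE gE hE.
have /(amap_exact _ Fres)[f' f'E] : (f - h' *m phi i.+1) *m amap F i = 0.
  by rewrite mulmxBl fE -[h' *m _ *m _]mulmxA -[h' *m _ *m _]mulmxA phiS subrr.
have /(amap_exact _ Gres)[g' g'E] : (g + h' *m psi i.+1) *m amap G i = 0.
  by rewrite mulmxDl gE -[h' *m _ *m _]mulmxA -[h' *m _ *m _]mulmxA psiS addNr.
exists (row_mx (row_mx f' g') h').
rewrite /= mul_row_block mul_row_block !mulmx0 addr0 add0r add0r.
rewrite mul_mx_row add_row_mx; congr (row_mx (row_mx _ _) _).
- by rewrite -[diff F i]/(amap F i.+1) -f'E subrK.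
- by rewrite -[diff G i]/(amap G i.+1) -g'E mulmxN addrK.
- by rewrite hE mulmxN.
Qed.

Lemma cone_resolves : resolves cone (ideal_add I J).
Proof.
have image (f : 'rV_(rank F 0)) (g : 'rV_(rank G 0)) (h : 'rV_0) :
    row_mx (row_mx f g) h *m aug cone = f *m aug F + g *m aug G.
  by rewrite /= !mul_row_col mulmx0 addr0.
have differential i (f : 'rV_(rank F i.+1)) (g : 'rV_(rank G i.+1)) (h : 'rV_(rank H i)) :
    row_mx (row_mx f g) h *m diff cone i =
    row_mx (row_mx (f *m diff F i + h *m phi i.+1) (g *m diff G i - h *m psi i.+1))
           (- (h *m susp_diff H i)).
  rewrite /= mul_row_block mul_row_block !mulmx0 addr0 add0r add0r.
  by rewrite mul_mx_row add_row_mx !mulmxN.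
have ddF i (f : 'rV_(rank F i.+1)) (h : 'rV_(rank H i)) :
    (f *m diff F i + h *m phi i.+1) *m amap F i = h *m amap H i *m phi i.
  by rewrite mulmxDl -[h *m phi i.+1 *m _]mulmxA phiS -[f *m _ *m _]mulmxA
             [diff F i *m _](amap_amap i Fres) mulmx0 add0r mulmxA.
have ddG i (g : 'rV_(rank G i.+1)) (h : 'rV_(rank H i)) :
    (g *m diff G i - h *m psi i.+1) *m amap G i = - (h *m amap H i *m psi i).
  by rewrite mulmxBl -[h *m psi i.+1 *m _]mulmxA psiS -[g *m _ *m _]mulmxA
             [diff G i *m _](amap_amap i Gres) mulmx0 add0r mulmxA.
split=> [f|v|i v].
- have [imF _ _] := Fres; have [imG _ _] := Gres; split=> [[a [b [Ia Jb ->]]]|[v ->]].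
    have [a' ->] := (imF a).1 Ia; have [b' ->] := (imG b).1 Jb.
    by exists (row_mx (row_mx a' b') 0); rewrite image [RHS]mxE.
  rewrite -[v]hsubmxK -[lsubmx v]hsubmxK image mxE.
  by eexists _, _; split; [apply/imF; eexists; reflexivity
                         | apply/imG; eexists; reflexivity |].
- rewrite -[v]hsubmxK -[lsubmx v]hsubmxK.
  move: (lsubmx (lsubmx v)) (rsubmx (lsubmx v)) (rsubmx v) => f g h {v}.
  split=> [|[w ->]]; last first.
    rewrite -[w]hsubmxK -[lsubmx w]hsubmxK differential image.
    transitivity (rsubmx w *m amap H 0 *m phi 0%N - rsubmx w *m amap H 0 *m psi 0%N).
      by congr (_ + _); [apply: (ddF 0%N) | apply: (ddG 0%N)].
    by rewrite phi0 psi0 !mulmx1 subrr.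
  rewrite image => fg0.
  have fgE : f *m aug F = - g *m aug G by apply/eqP; rewrite mulNmx -addr_eq0 fg0.
  (* The common value of both sides of fgE lies in the intersection; h' lifts it. *)
  have /(amap_image _ Hres)[h' h'E] : I ((f *m aug F) 0 0) /\ J ((f *m aug F) 0 0).
    by split; [apply/(amap_image _ Fres); exists f
              | rewrite fgE; apply/(amap_image _ Gres); exists (- g)].
  apply: (@cone_image 0 f g h h') => /=.
  + by rewrite phi0 mulmx1 -h'E.
  + by rewrite psi0 mulmx1 -h'E fgE mulNmx opprK.
  + by apply/rowP=> -[].
- split=> [|[w ->]]; last first.
    rewrite -[w]hsubmxK -[lsubmx w]hsubmxK !differential.
    move: (lsubmx (lsubmx w)) (rsubmx (lsubmx w)) (rsubmx w) => f g h {w v}.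
    apply: etrans (_ : row_mx (row_mx 0 0) 0 = 0); last by rewrite !row_mx0.
    congr (row_mx (row_mx _ _) _).
    + by rewrite [X in X + _](ddF i.+1 f h) mulNmx subrr.
    + by rewrite [X in X - _](ddG i.+1 g h) mulNmx subrr.
    + case: i h {f g} => [|i] h /=; first by rewrite mulmx0 oppr0.
      by rewrite mulNmx opprK -mulmxA [diff H _ *m _](amap_amap i.+1 Hres) mulmx0.
- rewrite -[v]hsubmxK -[lsubmx v]hsubmxK differential.
  move: (lsubmx (lsubmx v)) (rsubmx (lsubmx v)) (rsubmx v) => f g h {v} dv0.
  have [] := eq_row_mx (etrans dv0 (esym (row_mx0 _ _ _ _))).
  move=> /(fun E => eq_row_mx (etrans E (esym (row_mx0 _ _ _ _)))) [f0 g0] h0.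
  (* For i = 0 the third component is empty; that h is a cycle then comes from the
     first one, because phi 0 is the identity. *)
  have /(amap_exact _ Hres)[h' hE] : h *m amap H i = 0.
    case: i f g h f0 g0 h0 {dv0} => [|i] f g h f0 g0 h0; last first.
      by apply/eqP; rewrite -oppr_eq0; apply/eqP.
    by have := ddF 0%N f h; rewrite /= f0 mul0mx phi0 mulmx1.
  apply: (@cone_image i.+1 f g h (- h')).
  + by rewrite !mulNmx -hE; apply/eqP; rewrite -addr_eq0; apply/eqP.
  + by rewrite !mulNmx opprK -hE; apply/eqP; rewrite -subr_eq0; apply/eqP.
  + by rewrite mulNmx opprK.
Qed.

End Construction.

(** The shift hypotheses make the comparison maps vanish modulo the irrelevant ideal;
    without them the cone would resolve the sum but need not be minimal.  The last
    conclusion is what allows linear resolutions to be built by repeated cones. *)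
Theorem resolution_ideal_add F G H I J :
    minimal_graded_free_resolution F I -> minimal_graded_free_resolution G J ->
    minimal_graded_free_resolution H (fun f => I f /\ J f) ->
    (forall i (j : 'I_(rank H i)) (k : 'I_(rank F i)), shift k < shift j) ->
    (forall i (j : 'I_(rank H i)) (k : 'I_(rank G i)), shift k < shift j) ->
  exists C, [/\ minimal_graded_free_resolution C (ideal_add I J),
    forall i, rank C i = (rank F i + rank G i + susp_rank H i)%N
  & forall sigma : nat -> int,
      (forall i (k : 'I_(rank F i)), shift k = sigma i) ->
      (forall i (k : 'I_(rank G i)), shift k = sigma i) ->
      (forall i (j : 'I_(rank H i)), shift j = sigma i.+1) ->
      forall i (k : 'I_(rank C i)), shift k = sigma i].
Proof.
move=> [gF Fres finF /minimalP minF] [gG Gres finG /minimalP minG].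
move=> [gH Hres finH /minimalP minH] ltHF ltHG.
have [phi [phi0 gphi phiS]] := lift_chain gH gF Hres Fres (fun f => @proj1 _ _).
have [psi [psi0 gpsi psiS]] := lift_chain gH gG Hres Gres (fun f => @proj2 _ _).
exists (cone phi psi); split=> [|//|sigma sF sG sH i].
- split; [exact: cone_graded | exact: cone_resolves | exact: cone_finite_length |].
  apply/minimalP => i; rewrite /= !(map_block_mx, map_row_mx) minF minG !map_mxN !map_mx0.
  rewrite (positive_degree_constant_part (gphi i.+1) (ltHF i)).
  rewrite (positive_degree_constant_part (gpsi i.+1) (ltHG i)).
  have -> : map_mx (constant_part N K) (susp_diff H i) = 0.
    by case: i => [|i]; [apply: map_mx0 | apply: minH].
  by rewrite !oppr0 row_mx0 !block_mx0.
- rewrite /= /split_shift => k; case: (split_ordP k) => k' _.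
    by case: (split_ordP k') => k'' _.
  by case: i k' {k} => [[]//|i] k'; apply: sH.
Qed.
End Cone.

(** * Linear resolutions of monomial ideals *)

Section Linear.

Variables (N : nat) (K : fieldType).
Local Notation S := {mpoly K[N]}.
Implicit Types (I J : S -> Prop) (f g : S) (mu nu : 'X_{1..N}) (P Q V W : pred 'X_{1..N}).

Definition linear_resolution (d : nat) I (F : free_seq N K) :=
  minimal_graded_free_resolution F I /\
  forall i (k : 'I_(rank F i)), shift k = (d + i)%:Z.

Definition has_linear_resolution d I := exists F, linear_resolution d I F.

Lemma linear_ext d I J :
  (forall f, I f <-> J f) -> has_linear_resolution d I -> has_linear_resolution d J.
Proof. by move=> IJ [F [Fmin Fd]]; exists F; split=> //; apply: resolution_ext Fmin. Qed.

Lemma linear_zero d : has_linear_resolution d (fun f => f = 0).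
Proof.
exists (@FreeSeq N K (fun=> 0%N) (fun _ _ => 0) (fun=> 0) 0).
split=> [|i []//]; split=> [|||i []//]; first by split=> [[]|i []].
  2: by exists 0%N.
split=> [f|v|i v] /=.
- by split=> [->|[v ->]]; [exists 0 |]; rewrite mulmx0 mxE.
- by split=> _; [exists 0|]; apply/rowP=> j; rewrite ?mulmx0 ?mxE //; case: j.
- by split=> _; [exists 0|]; apply/rowP=> -[].
Qed.

Lemma linear_one : has_linear_resolution 0 (fun=> True).
Proof.
pose rk (i : nat) : nat := if i is 0 then 1 else 0.
exists (@FreeSeq N K rk (fun i _ => i%:Z) (fun=> 0) 1%:M); split=> //.
split=> [|||i []//]; last first.
- by exists 0%N => -[].
- split=> [f|v|i v] /=.
  + by split=> // _; exists (\row__ f); rewrite mulmx1 mxE.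
  + rewrite mulmx1; split=> [->|[w ->]]; last by rewrite mulmx0.
    by exists 0; rewrite mulmx0.
  + by split=> _; [exists 0|]; apply/rowP=> k; [case: k | rewrite mulmx0 mxE].
split=> [j|i []//] mu; rewrite /= !ord1 mxE eqxx -mpolyX0 => /mem_msuppXP <-.
by rewrite mdeg0.
Qed.

(** Multiplication by a variable is injective, so only the augmentation and the
    degree shifts change. *)
Lemma linear_mulX d I (x : 'I_N) :
  has_linear_resolution d I ->
  has_linear_resolution d.+1 (fun f => exists2 g, I g & f = 'X_x * g).
Proof.
case=> F [[[gaug gdiff] [imF ex0 exS] finF minF] Fd].
have X0 : 'X_x != 0 :> S by rewrite -msupp_eq0 msuppX.
exists (@FreeSeq N K (rank F) (fun i k => shift k + 1) (diff F) ('X_x *: aug F)).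
split=> [|i k /=]; last by rewrite Fd addSn -addn1 PoszD.
split=> //; split=> //=.
- move=> j; rewrite mxE addrC; apply: homogM => // mu /mem_msuppXP <-.
  by rewrite mdeg1.
- by move=> i j k; rewrite opprD addrACA subrr addr0.
- move=> f; split=> [[g /imF[v ->] ->]|[v ->]].
    by exists v; rewrite -scalemxAr [RHS]mxE.
  by exists ((v *m aug F) 0 0); [apply/imF; exists v | rewrite -scalemxAr [LHS]mxE].
- move=> v; rewrite -ex0 -scalemxAr; split=> [/matrixP v0|->]; last by rewrite scaler0.
  apply/matrixP => i j; have := v0 i j; rewrite !mxE => /eqP.
  by rewrite mulf_eq0 (negbTE X0) => /eqP.
Qed.

(** The intersection has to be generated one degree higher because the cone places
    its i-th module in position i + 1. *)
Lemma linear_add d I J :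
    has_linear_resolution d I -> has_linear_resolution d J ->
    has_linear_resolution d.+1 (fun f => I f /\ J f) ->
  has_linear_resolution d (ideal_add I J).
Proof.
case=> F [Fmin Fd] [G [Gmin Gd]] [H [Hmin Hd]].
have lt i : (d + i)%:Z < (d.+1 + i)%:Z by rewrite ltz_nat.
have [||C [Cmin _ Cd]] := resolution_ideal_add Fmin Gmin Hmin.
- by move=> i j k; rewrite Fd Hd.
- by move=> i j k; rewrite Gd Hd.
exists C; split=> //; apply: (Cd (fun i => (d + i)%:Z)) => // i j.
by rewrite Hd addSnnS.
Qed.

(** The monomials of a polynomial can be distributed between the two sets. *)
Lemma supported_ideal_add P Q f :
  ideal_add (supported P) (supported Q) f <-> supported (fun mu => P mu || Q mu) f.
Proof.
split=> [[g [h [gP hQ ->]]]|fPQ].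
  by apply: supportedD; [move: gP | move: hQ]; apply: supported_sub => mu ->; rewrite ?orbT.
exists (restrict P f), (restrict (predC P) f); split; last exact: restrictC.
  exact: supported_restrict.
move=> mu mu_in; have /= := supported_restrict_sub (P := predC P) fPQ mu_in.
by have /= /negbTE -> := supported_restrict mu_in.
Qed.

(** For a set of monomials that does not see the exponent of [x], divisibility by
    [x] is the only condition separating [W] from its product with [x]. *)
Lemma supported_mulX W (x : 'I_N) f :
    (forall mu, W (mu + U_(x))%MM = W mu) ->
  (exists2 g, supported W g & f = 'X_x * g) <->
  supported (fun mu => (mu x != 0%N) && W mu) f.
Proof.
move=> Wx; split=> [[g gW ->]|fW].
  apply: (supportedM (W1 := fun mu => mu = U_(x)%MM)) gW => [mu nu -> Wnu|].
    by rewrite mnmDE mnm1E eqxx addmC Wx.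
  by move=> mu /mem_msuppXP.
have mu_x mu : mu \in msupp f -> (mu - U_(x) + U_(x) = mu)%MM.
  by move=> /fW /andP[mux _]; rewrite submK // lep1mP.
exists (\sum_(mu <- msupp f) f@_mu *: 'X_[mu - U_(x)]).
  rewrite big_seq; apply: supported_sum => mu muf; apply: supportedZX.
  by rewrite -Wx mu_x //; case/andP: (fW _ muf).
rewrite {1}(mpolyE f) mulr_sumr big_seq [RHS]big_seq; apply: eq_bigr => mu muf.
by rewrite -scalerAr -mpolyXD addmC mu_x.
Qed.

Definition supp_count (s : seq 'I_N) mu : nat := count (fun x => mu x != 0%N) s.

Lemma supp_count_shift s x mu :
  x \notin s -> supp_count s (mu + U_(x))%MM = supp_count s mu.
Proof.
move=> xs; apply: eq_in_count => y ys /=; rewrite mnmDE mnm1E.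
have -> : (x == y) = false by apply: contraNF xs => /eqP ->.
by rewrite addn0.
Qed.

Lemma supp_count_addl s mu nu :
  (supp_count s mu <= supp_count s (nu + mu)%MM)%N.
Proof.
by apply: sub_count => x /=; rewrite mnmDE addn_eq0 negb_and => ->; rewrite orbT.
Qed.

(** Induction on the list of variables.  The condition [V] must ignore these
    variables, so that it passes unchanged through the multiplication by [x]. *)
Lemma linear_supp_count s V d a :
    uniq s -> (forall x mu, x \in s -> V (mu + U_(x))%MM = V mu) ->
    has_linear_resolution d (supported V) ->
  has_linear_resolution (d + a) (supported (fun mu => (a <= supp_count s mu)%N && V mu)).
Proof.
move=> + + Vlin; elim: s a => [|x s IHs] a /=.
  move=> _ _; case: a => [|a]; first by rewrite addn0.
  apply: linear_ext (linear_zero (d + a.+1)) => f.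
  split=> [->|f0]; first exact: supported0.
  by apply: (@supported_disjoint _ _ (fun=> False) _ f _ _ f0) => // mu /f0.
move=> /andP[xs s_uniq] Vs; case: a => [|a]; first by rewrite addn0.
have {}IHs b := IHs b s_uniq (fun y mu ys => Vs y mu (@mem_behead _ (x :: s) y ys)).
pose W b mu := (b <= supp_count s mu)%N && V mu.
have Wx b mu : W b (mu + U_(x))%MM = W b mu.
  by rewrite /W supp_count_shift // Vs ?mem_head.
have Wmul b f := @supported_mulX (W b) x f (Wx b).
rewrite addnS; have := @linear_add (d + a).+1
  (supported (W a.+1)) (supported (fun mu => (mu x != 0%N) && W a mu)).
case=> [|||F FP].
(* The three inputs of the cone: x ignored, x a divisor, and the intersection, which is
   x * W (a + 1) because W (a + 1) is contained in W a. *)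
- by rewrite -addnS; apply: IHs.
- exact: linear_ext (Wmul a) (linear_mulX x (IHs a)).
- rewrite -addnS; apply: linear_ext (linear_mulX x (IHs a.+1)) => f.
  rewrite (Wmul a.+1); split=> [fW|[fW1 fW2] mu muf].
    split; apply: supported_sub fW => mu /andP[mux /andP[lt Vmu]]; first exact/andP.
    by rewrite mux /W (ltnW lt).
  by rewrite -/(W a.+1 mu) fW1 // andbT; case/andP: (fW2 mu muf).
apply: linear_ext; last by exists F; exact: FP.
move=> f; rewrite supported_ideal_add.
suff WE mu : W a.+1 mu || (mu x != 0%N) && W a mu =
             (a < (mu x != 0%N) + supp_count s mu)%N && V mu.
  by split; apply: supported_sub => mu; rewrite WE.
rewrite /W; case: (V mu); rewrite ?(andbT, andbF) //.
case: (mu x != 0%N); last by rewrite orbF.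
by rewrite add1n ltnS /= orb_idl // => /ltnW.
Qed.

(** Imposing the two conditions one after the other on the full ring. *)
Lemma linear_two_supp_counts s s' a b : uniq (s ++ s') ->
  has_linear_resolution (a + b)
    (supported (fun mu => (a <= supp_count s mu)%N && (b <= supp_count s' mu)%N)).
Proof.
rewrite cat_uniq => /and3P[s_uniq disj s'_uniq].
rewrite addnC -[b]add0n; apply: linear_supp_count => // [x mu xs|].
  by rewrite supp_count_shift //; apply: contra disj => xs'; apply/hasP; exists x.
have := @linear_supp_count s' predT 0 b s'_uniq (fun _ _ _ => erefl).
case=> [|F FP]; first by apply: linear_ext linear_one => f.
apply: linear_ext; last by exists F; exact: FP.
by move=> f; split; apply: supported_sub => mu; rewrite andbT.
Qed.
End Linear.

(** * Products of squarefree Veronese ideals and the splitting *)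

Section SquarefreeProducts.

Section SquarefreeMonomials.
Variables (N k : nat) (K : fieldType) (e : 'I_k -> 'I_N).
Local Notation S := {mpoly K[N]}.
Hypothesis e_inj : injective e.
Implicit Types (mu nu : 'X_{1..N}) (A D : {set 'I_k}).

Definition sqfree_mnm A : 'X_{1..N} := (\sum_(i in A) U_(e i))%MM.

Lemma prod_vars A : \prod_(i in A) 'X_(e i) = 'X_[sqfree_mnm A] :> S.
Proof. exact: mprodXE. Qed.

Lemma sqfree_mnmE A j : sqfree_mnm A (e j) = (j \in A).
Proof.
rewrite mnm_sumE (eq_bigr (fun i => (i == j : nat))) => [|i _]; last first.
  by rewrite mnm1E (inj_eq e_inj).
case: (boolP (j \in A)) => jA; last first.
  by rewrite big1 // => i iA; case: eqP jA => // <-; rewrite iA.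
by rewrite (bigD1 j) //= eqxx big1 // => i /andP[_ /negbTE ->].
Qed.

Lemma sqfree_mnm_out A x : (forall i, e i != x) -> sqfree_mnm A x = 0%N.
Proof. by move=> ex; rewrite mnm_sumE big1 // => i _; rewrite mnm1E (negbTE (ex i)). Qed.

Lemma supp_count_image mu :
  supp_count [seq e i | i <- enum 'I_k] mu = #|[set i | mu (e i) != 0%N]|.
Proof.
by rewrite /supp_count count_map cardsE cardE -size_filter /enum_mem filter_predT.
Qed.

Lemma exists_sqfree_mnm a mu :
    (a <= supp_count [seq e i | i <- enum 'I_k] mu)%N ->
  exists A : {set 'I_k}, #|A| = a /\ forall i, (sqfree_mnm A (e i) <= mu (e i))%N.
Proof.
rewrite supp_count_image; set D := [set i | _] => aD.
exists [set i in take a (enum D)]; split.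
  by rewrite cardsE (card_uniqP _) ?take_uniq ?enum_uniq // size_takel -?cardE.
move=> i; rewrite sqfree_mnmE inE; case: (boolP (i \in take a _)) => // /mem_take.
by rewrite mem_enum inE lt0n.
Qed.

Lemma supported_sqfree_ideal a f :
    ideal_gen (fun f : S => exists A : {set 'I_k},
      #|A| = a /\ f = \prod_(i in A) 'X_(e i)) f ->
  supported (fun mu => (a <= supp_count [seq e i | i <- enum 'I_k] mu)%N) f.
Proof.
apply: supported_ideal_gen => [mu nu /leq_trans -> //|g [A [<- ->]] mu].
  exact: supp_count_addl.
rewrite prod_vars => /mem_msuppXP <-; rewrite supp_count_image subset_leq_card //.
by apply/subsetP => i iA; rewrite inE sqfree_mnmE iA.
Qed.
End SquarefreeMonomials.

Section Products.
Variables (n m : nat) (K : fieldType).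
Local Notation S := {mpoly K[n + m]}.

Definition xvars : seq 'I_(n + m) := [seq lshift m i | i <- enum 'I_n].
Definition yvars : seq 'I_(n + m) := [seq rshift n j | j <- enum 'I_m].

Definition bisupport a b (mu : 'X_{1..n + m}) :=
  (a <= supp_count xvars mu)%N && (b <= supp_count yvars mu)%N.

(** The x-part and the y-part of a monomial are coprime, so a squarefree divisor of
    each kind can be split off simultaneously. *)
Lemma ideal_mul_supported a b (f : S) :
  ideal_mul (Iideal n m K a) (Jideal n m K b) f <-> supported (bisupport a b) f.
Proof.
split.
  apply: supported_ideal_gen => [mu nu /andP[amu bmu]|g [p [q [Ip Jq ->]]]].
    by rewrite /bisupport (leq_trans amu) ?(leq_trans bmu) ?supp_count_addl.
  have pW := supported_sqfree_ideal (@lshift_inj n m) Ip.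
  have qW := supported_sqfree_ideal (@rshift_inj n m) Jq.
  apply: supportedM pW qW => mu nu amu bnu.
  rewrite /bisupport addmC (leq_trans amu) ?supp_count_addl //= addmC.
  by rewrite (leq_trans bnu) ?supp_count_addl.
move=> fab; apply: ideal_gen_monomials => mu /fab /andP[amu bmu].
have [A [cA leA]] := exists_sqfree_mnm (@lshift_inj n m) amu.
have [B [cB leB]] := exists_sqfree_mnm (@rshift_inj n m) bmu.
pose g := 'X_[sqfree_mnm (lshift m) A] : S.
pose h := 'X_[sqfree_mnm (@rshift n m) B] : S.
have le_mu : (sqfree_mnm (lshift m) A + sqfree_mnm (@rshift n m) B <= mu)%MM.
  apply/mnm_lepP => x; rewrite mnmDE; case: (split_ordP x) => y ->.
    by rewrite [X in (_ + X)%N]sqfree_mnm_out ?addn0 // => j; rewrite eq_rlshift.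
  by rewrite [X in (X + _)%N]sqfree_mnm_out ?add0n // => j; rewrite eq_lrshift.
exists 'X_[mu - (sqfree_mnm (lshift m) A + sqfree_mnm (@rshift n m) B)], (g * h).
split; last by rewrite -!mpolyXD submK.
exists g, h; split=> //; apply: ideal_gen_self.
  by exists A; rewrite prod_vars.
by exists B; rewrite prod_vars.
Qed.

Lemma uniq_vars : uniq (xvars ++ yvars).
Proof.
rewrite cat_uniq (map_inj_uniq (@lshift_inj n m)) (map_inj_uniq (@rshift_inj n m)).
rewrite !enum_uniq andbT; apply/hasPn => _ /mapP[j _ ->].
by apply/mapP => -[i _ /eqP]; rewrite eq_rlshift.
Qed.

Lemma linear_bisupport a b :
  has_linear_resolution (a + b) (supported (K := K) (bisupport a b)).
Proof. exact/linear_two_supp_counts/uniq_vars. Qed.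

End Products.

Theorem betti_splitting (n m : nat) (K : fieldType) (q r s t : nat) (i : nat) :
    (q < s)%N -> (t < r)%N ->
  betti i.+1 (ideal_add (ideal_mul (Iideal n m K q) (Jideal n m K r))
                        (ideal_mul (Iideal n m K s) (Jideal n m K t))) =
  (betti i.+1 (ideal_mul (Iideal n m K q) (Jideal n m K r)) +
   betti i.+1 (ideal_mul (Iideal n m K s) (Jideal n m K t)) +
   betti i (ideal_mul (Iideal n m K s) (Jideal n m K r)))%N.
Proof.
move=> qs tr.
have lin a b :
    has_linear_resolution (a + b) (ideal_mul (Iideal n m K a) (Jideal n m K b)).
  by apply: linear_ext (linear_bisupport n m K a b) => f; rewrite ideal_mul_supported.
have [[F [Fmin Fd]] [G [Gmin Gd]] [H [Hmin Hd]]] := And3 (lin q r) (lin s t) (lin s r).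
have HminI : minimal_graded_free_resolution H (fun f =>
    ideal_mul (Iideal n m K q) (Jideal n m K r) f /\
    ideal_mul (Iideal n m K s) (Jideal n m K t) f).
  apply: resolution_ext Hmin => f; rewrite !ideal_mul_supported.
  split=> [fsr|[fqr fst] mu muf].
    by split; apply: supported_sub fsr => mu /andP[smu rmu]; rewrite /bisupport
      ?smu ?rmu ?andbT ?(leq_trans (ltnW qs) smu) ?(leq_trans (ltnW tr) rmu).
  by apply/andP; split; [case/andP: (fst mu muf) | case/andP: (fqr mu muf)].
have [||C [Cmin rankC _]] := resolution_ideal_add Fmin Gmin HminI.
- by move=> j x y; rewrite Fd Hd ltz_nat !ltn_add2r.
- by move=> j x y; rewrite Gd Hd ltz_nat ltn_add2r ltn_add2l.
by rewrite (betti_rank _ Fmin) (betti_rank _ Gmin) (betti_rank _ Hmin)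
           (betti_rank _ Cmin) rankC.
Qed.
End SquarefreeProducts.

End BettiSplitting.

Theorem theorem3p3 (K : fieldType) (n m q r s t : nat)
    (hqs : q < s) (hsn : s <= n) (htr : t < r) (hrm : r <= m)
    (i : nat) (hi : 1 <= i) :
  betti i (ideal_add (ideal_mul (Iideal n m K q) (Jideal n m K r))
                     (ideal_mul (Iideal n m K s) (Jideal n m K t))) =
  betti i (ideal_mul (Iideal n m K q) (Jideal n m K r)) +
  betti i (ideal_mul (Iideal n m K s) (Jideal n m K t)) +
  betti i.-1 (ideal_mul (Iideal n m K s) (Jideal n m K r)).
Proof.
by case: i hi => // i _; apply: betti_splitting.
Qed.
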